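(* Let $P$ be a closed planar polyline in the $XZ$-plane, traversed from a starting vertex $S$ to the end point $E=S$, considered in a state of the T-type deformation in which no line-segment of $P$ is horizontal (parallel to the $X$-axis). Partition the line-segments of $P$ into classes as follows: the slope angle of each line-segment is taken in $[-90^\circ,90^\circ]$ (translate the line-segment so that one end point lies at the origin and the other lies in the first or fourth quadrant), and two line-segments belong to the same class if and only if their slopes have the same absolute value. Run through $P$ counter-clockwise, starting from $S$ until $E=S$ is reached, and assign to each line-segment its oriented length, which is its length with sign $+$ if the line-segment is traversed upwards (increasing $Z$) and with sign $-$ if it is traversed downwards (decreasing $Z$). If for every class the sum of the oriented lengths of its line-segments is zero, then $P$ is compatible with the isometric deformations of T-type.
   Context: A T-hedron is a discrete surface made of planar trapezoids, constructed as follows. A profile polyline $p_0$ lies in the vertical plane $\pi_0$ (the $XZ$-plane), and a trajectory polyline $t_0$ with vertices $V_{0,0},V_{1,0},\dots$ lies in the base plane $\tau_0$ (the $XY$-plane); the two polylines share the first vertex $V_{0,0}$. Through each vertex $V_{i,0}$ passes a plane $\pi_i$ orthogonal to $\tau_0$, and the polyline $p_i\subset\pi_i$ is the image of $p_{i-1}$ under parallel projection into $\pi_i$ in the direction of the edge $V_{i-1,0}V_{i,0}$. A T-hedral tube is a T-hedron whose profile polyline (cross-section) is closed. The T-type isometric deformation of a T-hedron is a one-parameter family with parameter $t$ (the distortion factor, varying within the flexion limits). It acts on the profile in the $XZ$-plane as follows: a directed line-segment with direction vector $(a,0,b)$ is transformed into the directed line-segment with vector $\left(ta,\,0,\,\varepsilon\sqrt{a^2+b^2-t^2a^2}\right)$,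 where $\varepsilon=\mathrm{sign}(b)$. The sign is fixed throughout the deformation, and $t$ is such that the radicands are nonnegative. The value $t=1$ gives the initial state, and the deformed line-segments are concatenated in the original order. A closed cross-section $P$ is called compatible with the isometric deformations of T-type if it remains closed under this deformation, i.e. the deformed start and end points coincide ($E^*=S^*$) for all admissible $t$. Without loss of generality there exists a state of deformation in which no line-segment is horizontal, as otherwise the structure cannot flex; horizontal line-segments occur only within a flexion limit. *)

(* Defs.v *)
From HB Require Import structures.
From mathcomp Require Import all_boot all_order all_algebra.
From mathcomp Require Import all_classical all_reals all_analysis.

Set Implicit Arguments.
Unset Strict Implicit.
Unset Printing Implicit Defensive.

Import Order.TTheory GRing.Theory Num.Theory.

Local Open Scope ring_scope.

(* A point or a vector (x, 0, z) of the XZ-plane is encoded as the pair (x, z).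
   A polyline with n line-segments is given by its n + 1 consecutive vertices,
   listed in the order of traversal; self-intersections are allowed. *)
Definition polyline (R : realType) (n : nat) := 'I_n.+1 -> R * R.

Definition closed_polyline (R : realType) (n : nat) (P : polyline R n) : Prop :=
  P ord_max = P ord0.

Definition segment (R : realType) (n : nat) (P : polyline R n) (i : 'I_n) :
    R * R :=
  P (lift ord0 i) - P (widen_ord (leqnSn n) i).

Definition horizontal (R : realType) (d : R * R) : bool := d.2 == 0.

Definition seg_length (R : realType) (d : R * R) : R :=
  Num.sqrt (d.1 ^+ 2 + d.2 ^+ 2).

Definition oriented_length (R : realType) (d : R * R) : R :=
  Num.sg d.2 * seg_length d.

(* Slope angle in [-pi/2, pi/2] of the undirected segment. The quotient
   d.2 / d.1 is unchanged when d is replaced by - d, so the segment need not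
   be turned into the half-plane x >= 0 first. A vertical segment may be given
   either angle pi/2 or - pi/2; only the absolute value is used below. *)
Definition slope_angle (R : realType) (d : R * R) : R :=
  if d.1 == 0 then pi / 2 else atan (d.2 / d.1).

Definition slope_classes (R : realType) (n : nat) (P : polyline R n) :
    {set {set 'I_n}} :=
  preim_partition (fun i => `|slope_angle (segment P i)|) [set: 'I_n].

Definition radicand (R : realType) (t : R) (d : R * R) : R :=
  d.1 ^+ 2 + d.2 ^+ 2 - t ^+ 2 * d.1 ^+ 2.

Definition deform_segment (R : realType) (t : R) (d : R * R) : R * R :=
  (t * d.1, Num.sg d.2 * Num.sqrt (radicand t d)).

Definition admissible (R : realType) (n : nat) (P : polyline R n) (t : R) :
    Prop :=
  forall i : 'I_n, 0 <= radicand t (segment P i).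

(* The deformed segments are concatenated from the starting vertex, which is
   kept in place: the T-type deformation only fixes a polyline up to
   translation. *)
Definition deform (R : realType) (n : nat) (t : R) (P : polyline R n) :
    polyline R n :=
  fun k => P ord0 + \sum_(i < n | (i < k)%N) deform_segment t (segment P i).

Definition T_compatible (R : realType) (n : nat) (P : polyline R n) : Prop :=
  forall t : R, admissible P t -> closed_polyline (deform t P).

(* Main.v *)
Require Import Defs.
From HB Require Import structures.
From mathcomp Require Import all_boot all_order all_algebra.
From mathcomp Require Import all_classical all_reals all_analysis.

Import Order.TTheory GRing.Theory Num.Theory.

Local Open Scope ring_scope.

(** A segment of length [L] and slope angle [a] has horizontal component
    [+/- L cos a], so its radicand equals [L^2 (1 - t^2 cos^2 a)]. The deformed
    vertical component is therefore the oriented length times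
    [sqrt (1 - t^2 cos^2 a)], a factor that only depends on [|a|], that is, on
    the class of the segment ([deform_segment_vertical]). Within a class the
    factor comes out of the sum, so the vertical displacement of the class is a
    multiple of its sum of oriented lengths, which is zero
    ([weighted_sum_eq0]). The horizontal components are all scaled by
    [t], and they sum to zero because [P] is closed ([sum_segments]). Hence the deformed segments add up to the null vector,
    which is what closedness of the deformed polyline means
    ([closed_deform]). *)

(** The cosine forgets the sign of the angle, so taking the absolute value,
    as the definition of the classes does, loses nothing here. *)
Lemma sqr_horizontal_component (R : realType) (d : R * R) :
  d.1 ^+ 2 = (d.1 ^+ 2 + d.2 ^+ 2) * cos `|slope_angle d| ^+ 2.
Proof.
rewrite cos_norm /slope_angle.
have [->|x_neq0] := eqVneq d.1 0.
  by rewrite cos_pihalf !expr0n /= mulr0.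
have -> : d.1 ^+ 2 + d.2 ^+ 2 = d.1 ^+ 2 * (1 + (d.2 / d.1) ^+ 2).
  by rewrite mulrDr mulr1 -exprMn mulrCA divff // mulr1.
have cos_neq0 : cos (atan (d.2 / d.1)) != 0.
  by rewrite gt_eqF // cos_gt0_pihalf // atan_gtNpi2 atan_ltpi2.
rewrite -[X in 1 + X ^+ 2]atanK -cos2_tan2 //.
by rewrite -mulrA mulVf ?mulr1 // expf_neq0.
Qed.

Lemma deform_segment_vertical (R : realType) (t : R) (d : R * R) :
  (deform_segment t d).2 =
  oriented_length d * Num.sqrt (1 - t ^+ 2 * cos `|slope_angle d| ^+ 2).
Proof.
rewrite /= /oriented_length /seg_length -mulrA; congr (_ * _).
rewrite -sqrtrM ?addr_ge0 ?sqr_ge0 //; congr Num.sqrt.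
by rewrite /radicand mulrBr mulr1 [in RHS]mulrCA -sqr_horizontal_component.
Qed.

Lemma sum_segments (R : realType) (n : nat) (P : polyline R n) :
  \sum_(i < n) segment P i = P ord_max - P ord0.
Proof.
rewrite /segment sumrB.
have := big_ord_recl _ P : \sum_k P k = _.
rewrite big_ord_recr /= => split_ends.
apply/eqP; rewrite subr_eq addrAC eq_sym subr_eq.
by rewrite [eqbLHS]addrC split_ends addrC.
Qed.

Lemma closed_deform (R : realType) (n : nat) (t : R) (P : polyline R n) :
  \sum_(i < n) deform_segment t (segment P i) = 0 ->
  closed_polyline (deform t P).
Proof.
move=> sum0; rewrite /closed_polyline /deform; congr (_ + _).
rewrite [RHS]big_pred0 // -[RHS]sum0.
by apply: eq_bigl => i; rewrite /= ltn_ord.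
Qed.

(** A weight that factors through [f] is constant on each fibre of [f], so it
    comes out of the sum over that fibre. *)
Lemma weighted_sum_eq0 (R : pzRingType) (I : finType) (T : eqType)
    (f : I -> T) (g : I -> R) (w : T -> R) :
  (forall C, C \in preim_partition f [set: I] -> \sum_(i in C) g i = 0) ->
  \sum_i g i * w (f i) = 0.
Proof.
move=> fibre_sums; pose Q := preim_partition f [set: I].
have partQ : finset.partition Q [set: I] by exact: preim_partitionP.
rewrite (eq_bigl [in [set: I]]) => [|i]; last by rewrite inE.
rewrite (set_partition_big _ partQ) /=.
apply: big1 => C QC; have := QC => /imsetP[x _ defC].
transitivity ((\sum_(i in C) g i) * w (f x)); last first.
  by rewrite fibre_sums ?mul0r.
rewrite mulr_suml.
by apply: eq_bigr => i; rewrite defC !inE /= => /eqP <-.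
Qed.

Theorem theorem3p1 (R : realType) (n : nat) (P : polyline R n)
  (P_closed : closed_polyline P)
  (P_nonhorizontal : forall i : 'I_n, ~~ horizontal (segment P i))
  (class_sums : forall C : {set 'I_n}, C \in slope_classes P ->
     \sum_(i in C) oriented_length (segment P i) = 0) :
  T_compatible P.
Proof.
move=> t _; apply: closed_deform.
apply: injective_projections; rewrite raddf_sum.
  have := congr1 fst (sum_segments R n P).
  rewrite P_closed subrr raddf_sum /= => sum_horizontal.
  by rewrite -mulr_sumr sum_horizontal mulr0.
rewrite (eq_bigr _ (fun i _ => deform_segment_vertical R t (segment P i))).
exact: (weighted_sum_eq0 _ _ _ (fun i => `|slope_angle (segment P i)|) _
          (fun a => Num.sqrt (1 - t ^+ 2 * cos a ^+ 2))).
Qed.
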